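(* For any set $I$, let $\mathrm{F_u}(I)$ be the set of all $\mathrm{Cyl}(\mathbb{R}^I)$-measurable functions $f\colon\mathbb{R}^I\to\mathbb{R}$ for which there exist a finite subset $J\subseteq I$ and nonnegative real numbers $(\lambda_j)_{j\in J}$ and $k$ with $|f|\leq k+\sum_{j\in J}\lambda_j|\pi_j|$. Then $\mathrm{F_u}(I)=\{f\colon\mathbb{R}^I\to\mathbb{R}\mid f\text{ preserves integrability over finite measure spaces}\}$, and $\mathrm{F_u}(I)$, with pointwise operations and with the constant function $1$ as weak unit, is the Dedekind $\sigma$-complete Riesz space with weak unit freely generated by the projections $\pi_i\colon\mathbb{R}^I\to\mathbb{R}$ ($i\in I$). The latter means: for every Dedekind $\sigma$-complete Riesz space $G$ with weak unit $1_G$ and every function $h\colon I\to G$, there is a unique $\sigma$-continuous Riesz morphism $\varphi\colon\mathrm{F_u}(I)\to G$ such that $\varphi(1)=1_G$ and $\varphi(\pi_i)=h(i)$ for all $i\in I$.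
   Context: $\mathrm{Cyl}(\mathbb{R}^I)$ is the smallest $\sigma$-algebra on $\mathbb{R}^I$ making every projection $\pi_i\colon\mathbb{R}^I\to\mathbb{R}$ measurable. For $p\in[1,+\infty)$ and a measure space $(\Omega,\mathcal{F},\mu)$, $\mathcal{L}^p(\mu)$ is the set of $\mathcal{F}$-measurable $f\colon\Omega\to\mathbb{R}$ with $\int_\Omega|f|^p\,d\mu<\infty$. A function $\tau\colon\mathbb{R}^I\to\mathbb{R}$ preserves $p$-integrability over finite measure spaces if for every measure space $(\Omega,\mathcal{F},\mu)$ with $\mu(\Omega)<\infty$ and every family $(f_i)_{i\in I}$ in $\mathcal{L}^p(\mu)$, the function $x\mapsto\tau((f_i(x))_{i\in I})$ is in $\mathcal{L}^p(\mu)$. This does not depend on $p\in[1,+\infty)$; $\tau$ preserves integrability over finite measure spaces if it holds for some (equivalently, every) such $p$. A weak unit of a Riesz space (vector lattice) $G$ is an element $1\in G$ with $1\geq0$ such that, for all $f\in G$, $f\land1=0$ implies $f=0$. A poset is Dedekind $\sigma$-complete if every nonempty countable subset that has an upper bound has a supremum. A map between posets is $\sigma$-continuous if it preserves all existing suprema of nonempty countable subsets. A Riesz morphism is a linear lattice homomorphism. *)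

(* Defs.v *)
From HB Require Import structures.
From mathcomp Require Import all_boot all_order all_algebra.
From mathcomp Require Import all_classical all_reals all_analysis measurable_realfun.

Set Implicit Arguments.
Unset Strict Implicit.
Unset Printing Implicit Defensive.

Import Order.TTheory GRing.Theory Num.Theory.
Import numFieldNormedType.Exports.

Local Open Scope classical_set_scope.
Local Open Scope ring_scope.

(* A Riesz space (vector lattice) over the ordered field R. The lattice operations
   are fields of the mixin, specified as greatest lower and least upper bounds,
   rather than inherited from Order.Lattice: HB refuses a join of Order.Lattice
   with modules once realDomainType is declared. *)
HB.mixin Record isRieszSpace (R : numDomainType) V
    of Num.POrderedZmodule V & GRing.Lmodule R V := {
  rmeet : V -> V -> V ;
  rjoin : V -> V -> V ;
  le_rmeet : forall x y z : V, (z <= rmeet x y) = (z <= x) && (z <= y) ;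
  rjoin_le : forall x y z : V, (rjoin x y <= z) = (x <= z) && (y <= z) ;
  riesz_leD2r : forall z x y : V, x <= y -> x + z <= y + z ;
  riesz_scale_ge0 : forall (a : R) (x : V), 0 <= a -> 0 <= x -> 0 <= a *: x
}.

#[short(type="rieszType")]
HB.structure Definition RieszSpace (R : numDomainType) :=
  { V of Num.POrderedZmodule V & GRing.Lmodule R V & isRieszSpace R V }.

Section riesz_notions.
Context {R : numDomainType}.

Definition weak_unit (G : rieszType R) (e : G) : Prop :=
  0 <= e /\ forall f : G, rmeet f e = 0 -> f = 0.

Definition riesz_morphism (F G : rieszType R) (phi : F -> G) : Prop :=
  [/\ linear phi,
      {morph phi : f g / rmeet f g >-> rmeet f g} &
      {morph phi : f g / rjoin f g >-> rjoin f g}].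

End riesz_notions.

Definition dedekind_sigma_complete d (T : porderType d) : Prop :=
  forall A : set T, A !=set0 -> countable A -> has_ubound A ->
    exists s, supremums A s.

Definition sigma_continuous d d' (T : porderType d) (T' : porderType d')
    (phi : T -> T') : Prop :=
  forall (A : set T) (s : T), A !=set0 -> countable A -> supremums A s ->
    supremums (phi @` A) (phi s).

Section integrability.
Context {R : realType} {I : Type}.

(* A measurableType is inhabited by convention of the library; this is harmless
   here, since every function on an empty measure space lies in L^p. *)
Definition preserves_pintegrability (p : R) (tau : (I -> R) -> R) : Prop :=
  forall (d : measure_display) (Omega : measurableType d)
    (mu : {measure set Omega -> \bar R}) (f : I -> Omega -> R),
    (mu [set: Omega] < +oo)%E -> (forall i, f i \in Lfun mu p%:E) ->
    (fun x => tau (fun i => f i x)) \in Lfun mu p%:E.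

Definition preserves_integrability (tau : (I -> R) -> R) : Prop :=
  exists2 p : R, 1 <= p & preserves_pintegrability p tau.

End integrability.

Section Fu.
Variables (R : realType) (I : Type).
Implicit Types f g h : (I -> R) -> R.

Definition cylinders : set (set (I -> R)) :=
  \bigcup_(i in [set: I])
    preimage_set_system [set: I -> R] (fun x => x i) measurable.

Definition Cyl := g_sigma_algebraType cylinders.

(* [{classic I}] is [I] itself, seen as a choiceType so that sums can be indexed
   by its finite subsets. *)
Definition affinely_dominated f : Prop :=
  exists (J : set {classic I}) (lambda : {classic I} -> R) (k : R),
    [/\ finite_set J, forall j, J j -> 0 <= lambda j, 0 <= k &
        forall x : I -> R, `|f x| <= k + \sum_(j \in J) lambda j * `|x j| ].

Definition Fu : set ((I -> R) -> R) :=
  [set f | measurable_fun [set: Cyl] (f : Cyl -> R) /\ affinely_dominated f].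

Let dominatedD f g h : affinely_dominated f -> affinely_dominated g ->
  (forall x, `|h x| <= `|f x| + `|g x|) -> affinely_dominated h.
Proof.
move=> [J [l [k [finJ l0 k0 fle]]]] [J' [l' [k' [finJ' l0' k0' gle]]]] hle.
pose m (K : set {classic I}) (u : {classic I} -> R) j := if j \in K then u j else 0.
have sumE (K : set {classic I}) (u : {classic I} -> R) (x : I -> R) :
    K `<=` J `|` J' ->
    \sum_(j \in K) u j * `|x j| = \sum_(j \in J `|` J') m K u j * `|x j|.
  move=> KJ; rewrite [RHS](_ : _ = \sum_(j \in K) m K u j * `|x j|).
    by apply: eq_fsbigr => j Kj; rewrite /m Kj.
  apply/esym/fsbig_widen => // j [_ nKj] /=.
  by rewrite /m memNset// mul0r.
exists (J `|` J'), (fun j => m J l j + m J' l' j), (k + k'); split.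
- by rewrite finite_setU.
- move=> j _; rewrite /m; apply: addr_ge0; case: ifPn => //; rewrite inE.
    exact: l0.
  exact: l0'.
- exact: addr_ge0.
- move=> x; apply: (le_trans (hle x)).
  apply: (le_trans (lerD (fle x) (gle x))).
  rewrite (sumE J)//.
  rewrite (sumE J')//.
  rewrite addrACA lerD2l -fsbig_split//=; last by rewrite finite_setU.
  by under [leRHS]eq_fsbigr do rewrite mulrDl.
Qed.

Lemma Fu_cst (c : R) : Fu (cst c).
Proof.
split; first exact: measurable_cst.
exists set0, (fun=> 0), `|c|; split => // x.
by rewrite fsbig_set0 addr0.
Qed.

Lemma Fu_proj (i : I) : Fu (fun x => x i).
Proof.
split.
  move=> _ Y mY; apply: sub_sigma_algebra; exists i => //.
  by exists Y.
exists [set (i : {classic I})], (fun=> 1), 0; split => // x.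
by rewrite fsbig_set1 add0r mul1r.
Qed.

Definition Fu_pred : {pred (I -> R) -> R} := mem Fu.

Let Fu_submod : submod_closed Fu_pred.
Proof.
split; first by rewrite inE; exact: (Fu_cst 0).
move=> a f g; rewrite !inE => -[mf [J [l [k [finJ l0 k0 fle]]]]] [mg dg].
split.
  apply: measurable_funD => //.
  exact: (measurable_funM (measurable_cst a)).
apply: (dominatedD (f := a *: f) _ dg); last by move=> x; exact: ler_normD.
exists J, (fun j => `|a| * l j), (`|a| * k); split => //.
- by move=> j Jj; rewrite mulr_ge0// l0.
- exact: mulr_ge0.
- move=> x; rewrite normrM -[leRHS]/(_ + _).
  under eq_fsbigr do rewrite -mulrA.
  by rewrite -mulr_fsumr -mulrDr ler_wpM2l.
Qed.

HB.instance Definition _ := GRing.isSubmodClosed.Build R ((I -> R) -> R)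
  Fu_pred Fu_submod.

Let Fu_meet : {in Fu_pred &, forall f g, Order.meet f g \in Fu_pred}.
Proof.
move=> f g; rewrite !inE => -[mf df] [mg dg]; split.
  have -> : Order.meet f g = (f \min g)%O.
    by apply/funext => x; rewrite meetfE meetEtotal.
  exact: (@measurable_minr _ Cyl R).
apply: (dominatedD df dg) => x; rewrite meetfE meetEtotal.
by rewrite /Order.min; case: ifPn => _; rewrite ?lerDl ?lerDr.
Qed.

Let Fu_join : {in Fu_pred &, forall f g, Order.join f g \in Fu_pred}.
Proof.
move=> f g; rewrite !inE => -[mf df] [mg dg]; split.
  have -> : Order.join f g = (f \max g)%O.
    by apply/funext => x; rewrite joinfE joinEtotal.
  exact: (@measurable_maxr _ Cyl R).
apply: (dominatedD df dg) => x; rewrite joinfE joinEtotal.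
by rewrite /Order.max; case: ifPn => _; rewrite ?lerDl ?lerDr.
Qed.

Record FuType := MkFu { Fu_fun :> (I -> R) -> R ; Fu_funP : Fu_fun \in Fu_pred }.

HB.instance Definition _ := [isSub for Fu_fun].
HB.instance Definition _ := [Choice of FuType by <:].
HB.instance Definition _ := [SubChoice_isSubLmodule of FuType by <:].
HB.instance Definition _ := [SubChoice_isSubPOrder of FuType by <: with ring_display].

Lemma Fu_leP (f g : FuType) : reflect (forall x, f x <= g x) (f <= g).
Proof. exact: lefP. Qed.

Definition Fu_rmeet (f g : FuType) : FuType :=
  MkFu (Fu_meet (Fu_funP f) (Fu_funP g)).
Definition Fu_rjoin (f g : FuType) : FuType :=
  MkFu (Fu_join (Fu_funP f) (Fu_funP g)).

Let Fu_le_rmeet (f g h : FuType) :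
  (h <= Fu_rmeet f g) = (h <= f) && (h <= g).
Proof.
apply/Fu_leP/andP => [hfg|[/Fu_leP hf /Fu_leP hg] x]; last first.
  by rewrite /= meetfE lexI hf hg.
by split; apply/Fu_leP => x; have := hfg x; rewrite /= meetfE lexI => /andP[].
Qed.

Let Fu_rjoin_le (f g h : FuType) :
  (Fu_rjoin f g <= h) = (f <= h) && (g <= h).
Proof.
apply/Fu_leP/andP => [hfg|[/Fu_leP hf /Fu_leP hg] x]; last first.
  by rewrite /= joinfE leUx hf hg.
by split; apply/Fu_leP => x; have := hfg x; rewrite /= joinfE leUx => /andP[].
Qed.

Let Fu_leD2r (h f g : FuType) : f <= g -> f + h <= g + h.
Proof. by move=> /Fu_leP fg; apply/Fu_leP => x; rewrite lerD2r. Qed.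

Let Fu_scale_ge0 (a : R) (f : FuType) : 0 <= a -> 0 <= f -> 0 <= a *: f.
Proof.
by move=> a0 /Fu_leP f0; apply/Fu_leP => x; apply: mulr_ge0 => //; exact: f0.
Qed.

HB.instance Definition _ := isRieszSpace.Build R FuType
  Fu_le_rmeet Fu_rjoin_le Fu_leD2r Fu_scale_ge0.

Lemma Fu_addE (f g : FuType) x : (f + g) x = f x + g x.
Proof. by []. Qed.

Lemma Fu_scaleE (a : R) (f : FuType) x : (a *: f) x = a * f x.
Proof. by []. Qed.

Lemma Fu_rmeetE (f g : FuType) x : rmeet f g x = Num.min (f x) (g x).
Proof. by rewrite -meetEtotal. Qed.

Lemma Fu_rjoinE (f g : FuType) x : rjoin f g x = Num.max (f x) (g x).
Proof. by rewrite -joinEtotal. Qed.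

Definition Fu_one : FuType := MkFu (mem_set (Fu_cst 1)).
Definition Fu_pi (i : I) : FuType := MkFu (mem_set (Fu_proj i)).

End Fu.

Arguments Fu_one {R I}.
Arguments Fu_pi {R I} i.

(* Main.v *)
(* Freeness. Let K be the smallest set of pairs (f, x) in F_u(I) x G containing
   (1, e) and the (pi_i, h i), closed under linear combinations, joins and
   countable suprema. The morphism is K itself: K is total because the sets
   whose indicator lies in its domain form a sigma-algebra containing the rays
   {pi_i > c}, and a nonnegative f is the supremum of the q 1_{f > q} over the
   rational q. That K is single-valued amounts to: (0, x) in K implies x = 0.
   This is a Rasiowa-Sikorski (forcing) argument. Nonzero positive elements u of G are
   conditions, "x <= y at u" means that u is disjoint from (x - y)^+, and a
   decreasing sequence of conditions meeting suitable countably many dense sets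
   gives each of the countably many elements of G involved in a derivation of
   (f, x) a real value, compatibly with the operations and with the countable
   suprema used. The values of the h i then form a point of R^I at which f takes
   the value of x. If x is not <= 0, a sequence starting at (x - q e)^+ for a
   small q > 0 gives x a value >= q, so f is not 0.

   Integrability. The zero measure on R^I shows that a preserving tau is
   Cyl-measurable; in particular it depends on countably many coordinates s_0,
   s_1, ... If no affine function of the |x_j| dominates it, choose x^n with
   |tau(x^n)| > 2^(n+1) (1 + sum_(m < n) |x^n_(s_m)|). The measure on nat with
   weights |tau(x^n)|^(-p) is finite and makes each coordinate p-integrable, but
   not tau. *)

Require Import Defs.
From HB Require Import structures.
From mathcomp Require Import all_boot all_order all_algebra.
From mathcomp Require Import all_classical all_reals all_analysis.
From mathcomp Require Import measurable_realfun.

Import Order.TTheory GRing.Theory Num.Theory.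
Import numFieldNormedType.Exports.

Local Open Scope classical_set_scope.
Local Open Scope ring_scope.

(** * Riesz spaces *)

Section riesz_theory.
Context {R : realType} {G : rieszType R}.
Implicit Types (x y z u v w : G) (a b : R).

Lemma riesz_leD2l z x y : x <= y -> z + x <= z + y.
Proof. by rewrite ![z + _]addrC; exact: riesz_leD2r. Qed.

Lemma riesz_leD x y z w : x <= y -> z <= w -> x + z <= y + w.
Proof.
by move=> xy zw; apply: le_trans (riesz_leD2l y _ _ zw); exact: riesz_leD2r.
Qed.

Lemma riesz_subr_ge0 x y : (0 <= y - x) = (x <= y).
Proof.
apply/idP/idP => [/(riesz_leD2r x)|/(riesz_leD2r (- x))].
  by rewrite add0r subrK.
by rewrite subrr.
Qed.

Lemma riesz_le_subr x y z : (x <= y - z) = (x + z <= y).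
Proof.
by rewrite -riesz_subr_ge0 -[RHS]riesz_subr_ge0 -addrA -opprD [z + x]addrC.
Qed.

Lemma riesz_le_subl x y z : (x - z <= y) = (x <= y + z).
Proof. by rewrite -[in RHS](opprK z) riesz_le_subr. Qed.

Lemma riesz_leN2 x y : (- x <= - y) = (y <= x).
Proof. by rewrite -(riesz_subr_ge0 (- x)) opprK addrC riesz_subr_ge0. Qed.

Lemma riesz_scale_le a x y : 0 <= a -> x <= y -> a *: x <= a *: y.
Proof.
move=> a0 xy; rewrite -riesz_subr_ge0 -scalerBr.
by apply: riesz_scale_ge0; rewrite // riesz_subr_ge0.
Qed.

Lemma riesz_scale_le2 a b x : 0 <= x -> a <= b -> a *: x <= b *: x.
Proof.
move=> x0 ab; rewrite -riesz_subr_ge0 -scalerBl.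
by apply: riesz_scale_ge0; rewrite // subr_ge0.
Qed.

Lemma rmeet_lel x y : rmeet x y <= x.
Proof. by have := lexx (rmeet x y); rewrite le_rmeet => /andP[]. Qed.

Lemma rmeet_ler x y : rmeet x y <= y.
Proof. by have := lexx (rmeet x y); rewrite le_rmeet => /andP[]. Qed.

Lemma rjoin_gel x y : x <= rjoin x y.
Proof. by have := lexx (rjoin x y); rewrite rjoin_le => /andP[]. Qed.

Lemma rjoin_ger x y : y <= rjoin x y.
Proof. by have := lexx (rjoin x y); rewrite rjoin_le => /andP[]. Qed.

Lemma rjoinC x y : rjoin x y = rjoin y x.
Proof. by apply: le_anti; rewrite !rjoin_le !rjoin_gel !rjoin_ger. Qed.

Lemma rmeet_mono x y z w : x <= y -> z <= w -> rmeet x z <= rmeet y w.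
Proof.
move=> xy zw; rewrite le_rmeet (le_trans (rmeet_lel _ _) xy).
by rewrite (le_trans (rmeet_ler _ _) zw).
Qed.

Lemma rmeet_ge0 x y : 0 <= x -> 0 <= y -> 0 <= rmeet x y.
Proof. by rewrite le_rmeet => -> ->. Qed.

Lemma rmeetDr x y z : rmeet (x + z) (y + z) = rmeet x y + z.
Proof.
apply: le_anti; rewrite le_rmeet.
rewrite !(riesz_leD2r _ _ _ (rmeet_lel _ _), riesz_leD2r _ _ _ (rmeet_ler _ _)).
by rewrite -riesz_le_subl le_rmeet !riesz_le_subl rmeet_lel rmeet_ler.
Qed.

Lemma rjoinDr x y z : rjoin (x + z) (y + z) = rjoin x y + z.
Proof.
apply: le_anti; rewrite rjoin_le.
rewrite !(riesz_leD2r _ _ _ (rjoin_gel _ _), riesz_leD2r _ _ _ (rjoin_ger _ _)).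
by rewrite -riesz_le_subr rjoin_le !riesz_le_subr rjoin_gel rjoin_ger.
Qed.

Lemma rmeetN x y : rmeet x y = - rjoin (- x) (- y).
Proof.
apply: le_anti; apply/andP; split.
  rewrite -[rmeet x y]opprK riesz_leN2 rjoin_le !riesz_leN2.
  by rewrite rmeet_lel rmeet_ler.
by rewrite le_rmeet -(riesz_leN2 x) -(riesz_leN2 y) opprK rjoin_gel rjoin_ger.
Qed.

Definition rpos x : G := rjoin x 0.

Lemma rpos_ge0 x : 0 <= rpos x.
Proof. exact: rjoin_ger. Qed.

Lemma rpos_ge x : x <= rpos x.
Proof. exact: rjoin_gel. Qed.

Lemma rpos_mono x y : x <= y -> rpos x <= rpos y.
Proof. by move=> xy; rewrite rjoin_le rpos_ge0 (le_trans xy (rpos_ge y)). Qed.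

Lemma ge0_rpos x : 0 <= x -> rpos x = x.
Proof.
by move=> x0; apply: le_anti; rewrite rpos_ge rjoin_le lexx x0.
Qed.

Lemma le0_rpos x : x <= 0 -> rpos x = 0.
Proof.
by move=> x0; apply: le_anti; rewrite rpos_ge0 rjoin_le lexx x0.
Qed.

Lemma rposE x : rpos x = x + rpos (- x).
Proof.
by rewrite /rpos [in RHS]addrC -rjoinDr addNr add0r rjoinC.
Qed.

Lemma rposD x y : rpos (x + y) <= rpos x + rpos y.
Proof.
rewrite rjoin_le riesz_leD ?rpos_ge//=.
by rewrite -[leLHS]addr0 riesz_leD ?rpos_ge0.
Qed.

Lemma rpos_disjoint x : rmeet (rpos x) (rpos (- x)) = 0.
Proof.
rewrite rposE -{2}[rpos (- x)]add0r rmeetDr rmeetN oppr0.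
by rewrite addNr.
Qed.

(** Moving [rmeet u y] to the left leaves bounds by [u] and by [x]; the second follows from
    [rmeet u y + x = rmeet (u + x) (y + x)]. *)
Lemma rmeetD_le u x y : 0 <= u -> 0 <= x -> 0 <= y ->
  rmeet u (x + y) <= rmeet u x + rmeet u y.
Proof.
move=> u0 x0 y0; have mu : rmeet u (x + y) <= u := rmeet_lel _ _.
rewrite -riesz_le_subl le_rmeet !riesz_le_subl; apply/andP; split.
  by rewrite (le_trans mu)// -[leLHS]addr0 riesz_leD// rmeet_ge0.
rewrite [leRHS]addrC -rmeetDr le_rmeet [y + x]addrC rmeet_ler andbT.
by rewrite (le_trans mu)// -[leLHS]addr0 riesz_leD.
Qed.

Lemma rpos_sub_trans x y z : rpos (x - z) <= rpos (x - y) + rpos (y - z).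
Proof. by rewrite (le_trans _ (rposD _ _))// addrA subrK. Qed.

Lemma rposZ a x : 0 <= a -> rpos (a *: x) = a *: rpos x.
Proof.
rewrite le_eqVlt => /predU1P[<-|a0]; first by rewrite !scale0r ge0_rpos.
have a0' := ltW a0.
apply: le_anti; rewrite rjoin_le riesz_scale_ge0 ?rpos_ge0//.
rewrite riesz_scale_le ?rpos_ge//=.
suff : rpos x <= a^-1 *: rpos (a *: x).
  move=> /(riesz_scale_le a _ _ (ltW a0)).
  by rewrite scalerA divff ?scale1r// gt_eqF.
have a'0 : 0 <= a^-1 by rewrite invr_ge0 ltW.
rewrite rjoin_le riesz_scale_ge0 ?rpos_ge0// andbT.
rewrite -{1}[x]scale1r -(mulVf (lt0r_neq0 a0)) -scalerA.
by rewrite riesz_scale_le// rpos_ge.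
Qed.

Lemma rmeet_eq0W u v x y : 0 <= v -> 0 <= y -> v <= u -> y <= x ->
  rmeet u x = 0 -> rmeet v y = 0.
Proof.
move=> v0 y0 vu yx ux; apply: le_anti; rewrite rmeet_ge0// andbT -ux.
exact: rmeet_mono.
Qed.

Lemma rmeet_eq0D u x y : 0 <= u -> 0 <= x -> 0 <= y ->
  rmeet u x = 0 -> rmeet u y = 0 -> rmeet u (x + y) = 0.
Proof.
move=> u0 x0 y0 ux uy; apply: le_anti; rewrite rmeet_ge0 ?riesz_leD// ?andbT.
  by rewrite (le_trans (rmeetD_le _ _ _ u0 x0 y0))// ux uy addr0.
by rewrite -[leLHS]addr0 riesz_leD.
Qed.

(** Natural multiples follow from additivity of disjointness; a real [a] lies below one of them. *)
Lemma rmeet_eq0Z u a x : 0 <= u -> 0 <= a -> 0 <= x ->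
  rmeet u x = 0 -> rmeet u (a *: x) = 0.
Proof.
move=> u0 a0 x0 ux.
have nx n : rmeet u (n%:R *: x) = 0.
  elim: n => [|n ih].
    by rewrite scale0r; apply: le_anti; rewrite rmeet_ler rmeet_ge0.
  rewrite -natr1 scalerDl scale1r; apply: rmeet_eq0D => //.
  exact: riesz_scale_ge0.
have := nx (Num.bound a); apply: rmeet_eq0W => //; first exact: riesz_scale_ge0.
by apply: riesz_scale_le2 => //; rewrite ltW// archi_boundP.
Qed.

Lemma disjointD_le x y z : rmeet x y = 0 -> x <= z -> y <= z -> x + y <= z.
Proof.
move=> xy xz yz; rewrite -[z]add0r -riesz_le_subl -xy le_rmeet !riesz_le_subl.
by rewrite riesz_leD2l//= addrC riesz_leD2l.
Qed.

(** With [w = rmeet u (rpos (s - c))], the element [s - w] still bounds [A], so [w <= 0]. Indeed,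
    for [g] in [A], [w] and [rpos (g - c)] are disjoint and both lie below [rpos (s - c)], hence so
    does their sum; the negative parts are then subtracted. *)
Lemma rmeet_eq0_sup u c (A : set G) s : 0 <= u -> supremums A s ->
  (forall g, A g -> rmeet u (rpos (g - c)) = 0) -> rmeet u (rpos (s - c)) = 0.
Proof.
move=> u0 [As sA] uA; set w := rmeet u (rpos (s - c)).
have w0 : 0 <= w by rewrite rmeet_ge0 ?rpos_ge0.
apply: le_anti; rewrite w0 andbT.
suff /sA : ubound A (s - w).
  by rewrite riesz_le_subr => /(riesz_leD2l (- s)); rewrite addKr addNr.
move=> g Ag; have gs : g <= s by exact: As.
have wg : w + rpos (g - c) <= rpos (s - c).
  apply: disjointD_le; first 1 last.
  - exact: rmeet_ler.
  - exact/rpos_mono/riesz_leD2r.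
  - by apply: rmeet_eq0W (uA _ Ag) => //; [exact: rpos_ge0|exact: rmeet_lel].
have gE : g - c = rpos (g - c) - rpos (- (g - c)) by rewrite {1}rposE addrK.
have : g - c + w <= s - c.
  rewrite gE addrAC riesz_le_subl [_ + w]addrC (le_trans wg)// (rposE (s - c)).
  by rewrite riesz_leD2l// rpos_mono// riesz_leN2 riesz_leD2r.
by move=> /(riesz_leD2r c); rewrite addrAC !subrK -riesz_le_subr.
Qed.

(** The supremum [s] of the multiples of [x] dominates each [n.+1%:R *: x], so [s - x] is again an
    upper bound and [s <= s - x]. *)
Lemma sigma_archimedean : dedekind_sigma_complete G ->
  forall x y, (forall n, n%:R *: x <= y) -> x <= 0.
Proof.
move=> dG x y nxy.
have [|||s [sA As]] := dG (range (fun n => n%:R *: x)).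
- by exists (0%:R *: x), 0%N.
- exact: sub_countable (card_image_le _ _) _.
- by exists y => _ [n _ <-]; exact: nxy.
have : s <= s - x.
  apply: As => _ [n _ <-]; rewrite riesz_le_subr.
  by apply: sA; exists n.+1 => //; rewrite -natr1 scalerDl scale1r.
by rewrite riesz_le_subr => /(riesz_leD2l (- s)); rewrite addKr addNr.
Qed.

End riesz_theory.

(** * Forcing with nonzero positive elements *)

Section local_order.
Context {R : realType} {G : rieszType R}.
Implicit Types (x y z u v : G) (a b q r s t : R).

(* For u >= 0: x <= y on the band generated by u. *)
Definition local_le u x y : Prop := rmeet u (rpos (x - y)) = 0.

Lemma le_local_le u x y : 0 <= u -> x <= y -> local_le u x y.
Proof.
move=> u0 xy; rewrite /local_le (le0_rpos (x - y)); last first.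
  by rewrite riesz_le_subl add0r.
by apply: le_anti; rewrite rmeet_ler rmeet_ge0.
Qed.

Lemma local_leW u v x y : 0 <= v -> v <= u -> local_le u x y -> local_le v x y.
Proof. by move=> v0 vu; apply: rmeet_eq0W => //; exact: rpos_ge0. Qed.

Lemma local_le_trans u y x z : 0 <= u ->
  local_le u x y -> local_le u y z -> local_le u x z.
Proof.
move=> u0 xy yz.
have := rmeet_eq0D _ _ _ u0 (rpos_ge0 _) (rpos_ge0 _) xy yz.
by apply: rmeet_eq0W => //; [exact: rpos_ge0|exact: rpos_sub_trans].
Qed.

Lemma local_leD2r u z x y : local_le u x y -> local_le u (x + z) (y + z).
Proof. by rewrite /local_le opprD addrACA subrr addr0. Qed.

Lemma local_leD u x y x' y' : 0 <= u ->
  local_le u x y -> local_le u x' y' -> local_le u (x + x') (y + y').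
Proof.
move=> u0 xy /(local_leD2r u y); rewrite ![_ + y]addrC => xy'.
by apply: local_le_trans xy' => //; exact: local_leD2r.
Qed.

Lemma local_leN u x y : local_le u x y -> local_le u (- y) (- x).
Proof. by rewrite /local_le opprK addrC. Qed.

Lemma local_leZ u a x y : 0 <= u -> 0 <= a ->
  local_le u x y -> local_le u (a *: x) (a *: y).
Proof.
move=> u0 a0 xy; rewrite /local_le -scalerBr rposZ//.
by apply: rmeet_eq0Z => //; exact: rpos_ge0.
Qed.

Lemma local_le_join u x y z : 0 <= u ->
  local_le u x z -> local_le u y z -> local_le u (rjoin x y) z.
Proof.
move=> u0 xz yz.
have := rmeet_eq0D _ _ _ u0 (rpos_ge0 _) (rpos_ge0 _) xz yz.
apply: rmeet_eq0W => //; first exact: rpos_ge0.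
have sum0 : 0 <= rpos (x - z) + rpos (y - z).
  by rewrite -[leLHS]addr0 riesz_leD ?rpos_ge0.
rewrite -rjoinDr rjoin_le sum0 andbT rjoin_le.
rewrite -{1}[x - z]addr0 -{2}[y - z]add0r.
by rewrite !riesz_leD ?rpos_ge ?rpos_ge0.
Qed.

Lemma local_le_rposB x y : local_le (rpos (x - y)) y x.
Proof. by rewrite /local_le -[y - x]opprB rpos_disjoint. Qed.

(** If [x <= y] fails at [u], the nonzero element [rmeet u (rpos (x - y))] is a stronger condition,
    disjoint from [rpos (y - x)]. *)
Lemma local_le_or u x y : 0 <= u ->
  local_le u x y \/ exists v, [/\ 0 < v, v <= u & local_le v y x].
Proof.
move=> u0; have [|nxy] := pselect (local_le u x y); first by left.
right; exists (rmeet u (rpos (x - y))); split.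
- by rewrite lt_def rmeet_ge0 ?rpos_ge0// andbT; apply/eqP.
- exact: rmeet_lel.
- apply: local_leW (local_le_rposB x y); first by rewrite rmeet_ge0 ?rpos_ge0.
  exact: rmeet_ler.
Qed.

Context (e : G).
Hypotheses (dG : dedekind_sigma_complete G) (we : weak_unit e).

Let e_ge0 : 0 <= e := we.1.

(** If [b < a], then [u] is disjoint from a positive multiple of [e], hence from [e], which a weak
    unit forbids for [u > 0]. *)
Lemma local_le_unit u a b : 0 < u -> local_le u (a *: e) (b *: e) -> a <= b.
Proof.
move=> u0; rewrite /local_le -scalerBl; case: (lerP a b) => // ba.
have ab0 : 0 < a - b by rewrite subr_gt0.
rewrite ge0_rpos; last by rewrite riesz_scale_ge0// ltW.
move=> uabe; have /we.2 ue : rmeet u e = 0.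
  rewrite -[e]scale1r -(mulVf (lt0r_neq0 ab0)) -scalerA.
  by apply: rmeet_eq0Z => //; rewrite ?invr_ge0 ?riesz_scale_ge0// ltW.
by rewrite ue ltxx in u0.
Qed.

(** Otherwise every [n%:R *: e] is below [x] at [u], so all multiples of [rmeet u e] are below
    [rpos x]. The Archimedean property gives [rmeet u e = 0], contradicting that [e] is a weak
    unit. *)
Lemma local_ubound u x : 0 < u ->
  exists v, exists n, [/\ 0 < v, v <= u & local_le v x (n%:R *: e)].
Proof.
move=> u0; apply: contrapT => no.
have u0' := ltW u0.
have {}no n : local_le u (n%:R *: e) x.
  have [//|[v [v0 vu vx]]] := local_le_or _ (n%:R *: e) x u0'.
  by exfalso; apply: no; exists v, n.
suff /we.2 ue : rmeet u e = 0 by rewrite ue ltxx in u0.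
apply: le_anti; rewrite rmeet_ge0// andbT.
apply: (sigma_archimedean dG _ (rpos x)) => n.
have hn : rmeet u (rpos (n%:R *: e - rpos x)) = 0.
  apply: local_le_trans (no n) _ => //; apply: le_local_le => //.
  exact: rpos_ge.
case: n hn => [|n] hn; first by rewrite scale0r rpos_ge0.
have n0 : 0 < n.+1%:R :> R by [].
rewrite -[leRHS]scale1r -[in leRHS](mulfV (lt0r_neq0 n0)) -scalerA.
apply: riesz_scale_le; first exact: ltW.
set y := _ *: rpos x.
have y0 : 0 <= y by rewrite riesz_scale_ge0 ?rpos_ge0// invr_ge0 ltW.
have hy : rmeet u (rpos (e - y)) = 0.
  have := local_leZ u n.+1%:R^-1 _ _ u0' _ hn.
  rewrite invr_ge0 ltW// /local_le -/y scalerA mulVf ?gt_eqF// scale1r.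
  exact.
have /le_trans : rmeet u e <= rmeet u (rpos (e - y) + y).
  apply: rmeet_mono => //; rewrite -riesz_le_subl; exact: rpos_ge.
apply; rewrite (le_trans (rmeetD_le _ _ _ u0' (rpos_ge0 _) y0))//.
by rewrite hy add0r rmeet_ler.
Qed.

Definition dense_cond (D : set G) : Prop :=
  forall u, 0 < u -> exists v, [/\ 0 < v, v <= u & D v].

Definition decides x q : set G :=
  [set v | local_le v x (q *: e) \/ local_le v (q *: e) x].

Definition bounds x : set G :=
  [set v | exists n, local_le v x (n%:R *: e) /\ local_le v (- n%:R *: e) x].

(** Meant for [x] the supremum of [g]: a condition in this set that does not force [x <= q] has a
    definite [g n] as witness, which ties the value of [x] to those of the [g n]. *)
Definition decides_sup (g : nat -> G) x q : set G :=
  [set v | local_le v x (q *: e) \/ exists n, local_le v (q *: e) (g n)].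

Lemma dense_decides x q : dense_cond (decides x q).
Proof.
move=> u u0; have [ux|[v [v0 vu vx]]] := local_le_or u x (q *: e) (ltW u0).
  by exists u; split => //; left.
by exists v; split => //; right.
Qed.

Lemma dense_bounds x : dense_cond (bounds x).
Proof.
move=> u /(local_ubound _ x)[v [n [v0 vu vx]]].
have [w [m [w0 wv wx]]] := local_ubound _ (- x) v0.
exists w; split => //; first exact: le_trans vu.
have le_e (k l : nat) : (k <= l)%N -> local_le w (k%:R *: e) (l%:R *: e).
  move=> kl; apply: le_local_le; first exact: ltW.
  by apply: riesz_scale_le2 => //; rewrite ler_nat.
have w0' := ltW w0.
exists (maxn n m); split.
  apply: local_le_trans (le_e _ _ (leq_maxl n m)) => //.
  exact: local_leW vx.
rewrite -[x]opprK scaleNr; apply: local_leN.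
exact: local_le_trans (le_e _ _ (leq_maxr n m)).
Qed.

(** If no condition below [u] forces some [g n] above [q], then every [g n] is below [q] at [u], and
    so is their supremum by [rmeet_eq0_sup]. *)
Lemma dense_decides_sup (g : nat -> G) x q : supremums (range g) x ->
  dense_cond (decides_sup g x q).
Proof.
move=> gx u u0; apply: contrapT => no.
have ug n : local_le u (g n) (q *: e).
  have [//|[v [v0 vu vg]]] := local_le_or u (g n) (q *: e) (ltW u0).
  by exfalso; apply: no; exists v; split => //; right; exists n.
apply: no; exists u; split => //; left.
by apply: rmeet_eq0_sup gx _; [exact: ltW|move=> _ [n _ <-]; exact: ug].
Qed.

Definition generic (DD : set (set G)) (u : nat -> G) : Prop :=
  [/\ forall n, 0 < u n, forall n, u n.+1 <= u n &
      forall D, DD D -> exists n, D (u n)].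

Lemma generic_sub (DD EE : set (set G)) (u : nat -> G) : EE `<=` DD ->
  generic DD u -> generic EE u.
Proof. by move=> ED [u0 ud uD]; split => // D /ED; exact: uD. Qed.

(** The Rasiowa-Sikorski construction: the dense sets are met one after another along a decreasing
    sequence. *)
Lemma generic_exists (DD : set (set G)) u : countable DD ->
  (forall D, DD D -> dense_cond D) -> 0 < u ->
  exists2 w, generic DD w & w 0%N = u.
Proof.
move=> /countable_injP[f finj] dDD u0.
(* By injectivity of [f], [D n] is the member of [DD] coded by [n], or the full set if there is
   none. *)
pose D n := [set v | forall E, DD E -> f E = n -> E v].
have dD n : dense_cond (D n).
  have [[E [DDE fE]]|nE] := pselect (exists E, DD E /\ f E = n).
    move=> v v0; have [w [w0 wv Ew]] := dDD _ DDE _ v0.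
    exists w; split => // E' DDE' fE'.
    by rewrite (finj E' E) ?inE// fE fE'.
  by move=> v v0; exists v; split => // E DDE fE; exfalso; apply: nE; exists E.
have /choice[step stepP] : forall p : nat * G, exists v,
    0 < p.2 -> [/\ 0 < v, v <= p.2 & D p.1 v].
  move=> [n v] /=; have [v0|] := pselect (0 < v); last by exists v.
  by have [w] := dD n v v0; exists w.
pose fix w n := if n is n'.+1 then step (n', w n') else u.
have w0 n : 0 < w n by elim: n => //= n ih; have [] := stepP (n, w n) ih.
exists w => //; split => // [n|E DDE].
  by have [] := stepP (n, w n) (w0 n).
(* Stage 0 is [u] itself, so the set coded by [n] is met at stage [n.+1]. *)
by exists (f E).+1; have [_ _] := stepP (f E, w (f E)) (w0 _); exact.
Qed.

(** * Real values of elements along a decreasing sequence of conditions *)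

Section values.
Context (u : nat -> G).
Hypotheses (u_gt0 : forall n, 0 < u n) (u_dec : forall n, u n.+1 <= u n).

Definition ev_le x y : Prop := exists n, local_le (u n) x y.

Let u_ge0 n : 0 <= u n := ltW (u_gt0 n).

Let u_mono m n : (m <= n)%N -> u n <= u m.
Proof.
move=> /subnK <-; elim: (n - m)%N => // k ih.
exact: le_trans (u_dec _) ih.
Qed.

Let common x y x' y' : ev_le x y -> ev_le x' y' ->
  exists n, local_le (u n) x y /\ local_le (u n) x' y'.
Proof.
move=> [n nxy] [m mxy]; exists (maxn n m); split.
  by apply: local_leW nxy => //; exact/u_mono/leq_maxl.
by apply: local_leW mxy => //; exact/u_mono/leq_maxr.
Qed.

Lemma le_ev_le x y : x <= y -> ev_le x y.
Proof. by exists 0%N; exact: le_local_le. Qed.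

Lemma ev_le_trans y x z : ev_le x y -> ev_le y z -> ev_le x z.
Proof.
move=> xy yz; have [n [? ?]] := common _ _ _ _ xy yz.
by exists n; apply: (local_le_trans _ y).
Qed.

Lemma ev_leD x y x' y' : ev_le x y -> ev_le x' y' -> ev_le (x + x') (y + y').
Proof.
move=> xy yz; have [n [? ?]] := common _ _ _ _ xy yz.
by exists n; apply: local_leD.
Qed.

Lemma ev_le_join x y z : ev_le x z -> ev_le y z -> ev_le (rjoin x y) z.
Proof.
move=> xy yz; have [n [? ?]] := common _ _ _ _ xy yz.
by exists n; apply: local_le_join.
Qed.

Lemma ev_leN x y : ev_le x y -> ev_le (- y) (- x).
Proof. by move=> [n ?]; exists n; exact: local_leN. Qed.

Lemma ev_leZ a x y : 0 <= a -> ev_le x y -> ev_le (a *: x) (a *: y).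
Proof. by move=> a0 [n ?]; exists n; exact: local_leZ. Qed.

Lemma ev_le_unit a b : ev_le (a *: e) (b *: e) -> a <= b.
Proof. by move=> [n]; exact: local_le_unit. Qed.

Lemma ev_le_scale a b x : a <= b -> ev_le (b *: e) x -> ev_le (a *: e) x.
Proof. by move=> ab; apply: ev_le_trans; apply/le_ev_le/riesz_scale_le2. Qed.

Lemma ev_le_scaler a b x : a <= b -> ev_le x (a *: e) -> ev_le x (b *: e).
Proof.
by move=> ab xa; apply: ev_le_trans xa _; apply/le_ev_le/riesz_scale_le2.
Qed.

(** Only strict comparisons with [r] are asked for: a comparison of [x] with [r *: e] itself need
    not hold at any stage. *)
Definition value x r : Prop :=
  (forall q, r < q -> ev_le x (q *: e)) /\
  (forall q, q < r -> ev_le (q *: e) x).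

Lemma value_ge x r q : value x r -> ev_le (q *: e) x -> q <= r.
Proof.
move=> [xr _] qx; apply/ler_addgt0Pr => eps eps0.
by apply: ev_le_unit; apply: ev_le_trans qx _; apply: xr; rewrite ltrDl.
Qed.

Lemma value_unit : value e 1.
Proof.
rewrite -[X in value X]scale1r; split=> q q1;
  by apply/le_ev_le/riesz_scale_le2 => //; exact: ltW.
Qed.

Lemma valueD x y r s : value x r -> value y s -> value (x + y) (r + s).
Proof.
move=> [xr rx] [ys sy]; split=> q.
  rewrite -subr_gt0 => q0; have d0 := divr_gt0 q0 (ltr0Sn R 1).
  suff -> : q = (r + (q - (r + s)) / 2) + (s + (q - (r + s)) / 2).
    by rewrite scalerDl; apply: ev_leD; [apply: xr|apply: ys]; rewrite ltrDl.
  by rewrite addrACA -splitr addrC subrK.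
rewrite -subr_gt0 => q0; have d0 := divr_gt0 q0 (ltr0Sn R 1).
suff -> : q = (r - (r + s - q) / 2) + (s - (r + s - q) / 2).
  rewrite scalerDl; apply: ev_leD; [apply: rx|apply: sy];
  by rewrite ltrBlDr ltrDl.
by rewrite addrACA -opprD -splitr subKr.
Qed.

Lemma valueN x r : value x r -> value (- x) (- r).
Proof.
move=> [xr rx]; split=> q rq; rewrite -[q]opprK scaleNr; apply: ev_leN.
  by apply: rx; rewrite ltrNl.
by apply: xr; rewrite ltrNr.
Qed.

Lemma valueZ_ge0 a x r : 0 <= a -> value x r -> value (a *: x) (a * r).
Proof.
rewrite le_eqVlt => /predU1P[<- _|a0 [xr rx]].
  rewrite scale0r mul0r; split=> q q0; rewrite -(scale0r e);
    by apply/le_ev_le/riesz_scale_le2 => //; exact: ltW.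
split=> q rq; have -> : q = a * (q / a) by rewrite mulrC divfK ?gt_eqF.
  rewrite -scalerA; apply: ev_leZ (ltW a0) _; apply: xr.
  by rewrite ltr_pdivlMr// mulrC.
rewrite -scalerA; apply: ev_leZ (ltW a0) _; apply: rx.
by rewrite ltr_pdivrMr// mulrC.
Qed.

Lemma valueZ a x r : value x r -> value (a *: x) (a * r).
Proof.
have [a0|a0] := leP 0 a; first exact: valueZ_ge0.
move=> /valueN/(valueZ_ge0 (- a)); rewrite scalerN scaleNr opprK mulrNN.
by apply; rewrite oppr_ge0 ltW.
Qed.

Lemma value_join x y r s : value x r -> value y s ->
  value (rjoin x y) (Num.max r s).
Proof.
move=> [xr rx] [ys sy]; split=> q; last rewrite lt_max => /orP[|].
- by rewrite gt_max => /andP[rq sq]; apply: ev_le_join; [exact: xr|exact: ys].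
- by move=> /rx /ev_le_trans; apply; exact/le_ev_le/rjoin_gel.
- by move=> /sy /ev_le_trans; apply; exact/le_ev_le/rjoin_ger.
Qed.

(** The value is the Dedekind cut of the [q] with [q *: e] eventually below [x]: [bounds] makes it
    finite, and deciding rationals above the cut gives the upper estimates. *)
Lemma value_exists x : (exists n, bounds x (u n)) ->
  (forall q : rat, exists n, decides x (ratr q) (u n)) -> exists r, value x r.
Proof.
move=> [m [n [xn nx]]] dx; pose A := [set q : R | ev_le (q *: e) x].
have supA : has_sup A.
  split; first by exists (- n%:R), m.
  by exists n%:R => q qx; apply: ev_le_unit; apply: ev_le_trans qx _; exists m.
exists (sup A); split=> q.
  move=> /rat_in_itvoo[q']; rewrite in_itv/= => /andP[rq' q'q].
  apply: (ev_le_scaler _ _ _ (ltW q'q)).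
  have [k [?|q'x]] := dx q'; first by exists k.
  suff : ratr q' <= sup A by rewrite leNgt rq'.
  by apply: sup_upper_bound => //; exists k.
move=> /(sup_gt supA.1)[q' Aq' qq'].
by apply: (ev_le_scale _ _ _ (ltW qq')).
Qed.

(** For a rational [q' > t], the second alternative of [decides_sup] would give some [g n] a value
    at least [q'], so [x] is eventually below [q']. Below [t], some [r n] already exceeds [q]. *)
Lemma value_sup (g : nat -> G) (r : nat -> R) x t :
  supremums (range g) x ->
  (forall q : rat, exists n, decides_sup g x (ratr q) (u n)) ->
  (forall n, value (g n) (r n)) -> supremums (range r) t -> value x t.
Proof.
move=> [gx _] dx gr [rt tr]; split=> q.
  move=> /rat_in_itvoo[q']; rewrite in_itv/= => /andP[rq' q'q].
  apply: (ev_le_scaler _ _ _ (ltW q'q)).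
  have [k [?|[n q'x]]] := dx q'; first by exists k.
  suff : ratr q' <= t by rewrite leNgt rq'.
  rewrite (@le_trans _ _ (r n))//; last by apply: rt; exists n.
  by apply: value_ge (gr n) _; exists k.
move=> qt; have [n qr] : exists n, q < r n.
  apply: contrapT => no; move: qt; rewrite ltNge => /negP; apply.
  apply: tr => _ [n _ <-]; rewrite leNgt; apply/negP => qr.
  by apply: no; exists n.
apply: ev_le_trans ((gr n).2 _ qr) _.
by apply/le_ev_le/gx; exists n.
Qed.

End values.
End local_order.

(** * The graph of the universal morphism *)

Lemma countable_range (T : Type) (A : set T) : A !=set0 -> countable A ->
  exists f : nat -> T, A = range f.
Proof.
move=> A0 /pfcard_geP[A0'|[f]]; first by rewrite A0' in A0; case: A0.
exists f; apply/esym; rewrite -[LHS]/(f @` setT); exact: image_eq.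
Qed.

(** * Suprema and affine bounds in [FuType] *)

Section Fu_order.
Context {R : realType} {I : Type}.
Implicit Types f g : FuType R I.

Lemma Fu_oppE f x : (- f) x = - f x.
Proof. by []. Qed.

Lemma Fu_zeroE x : (0 : FuType R I) x = 0.
Proof. by []. Qed.

Lemma Fu_oneE x : (Fu_one : FuType R I) x = 1.
Proof. by []. Qed.

Lemma Fu_eqP f g : (forall x, f x = g x) -> f = g.
Proof. by move=> fg; apply/val_inj/funext. Qed.

Lemma Fu_sumE (J : Type) (s : seq J) (F : J -> FuType R I) x :
  (\sum_(j <- s) F j) x = \sum_(j <- s) F j x.
Proof.
by elim: s => [|j s ih]; rewrite ?big_nil// !big_cons Fu_addE ih.
Qed.

Lemma Fu_measurable f : measurable_fun [set: Cyl R I] (f : Cyl R I -> R).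
Proof. by have := Fu_funP f; rewrite inE => -[]. Qed.

Lemma Fu_dominated_le (f g : (I -> R) -> R) : affinely_dominated g ->
  (forall x, `|f x| <= `|g x|) -> affinely_dominated f.
Proof.
move=> [J [l [k [finJ l0 k0 gle]]]] fg; exists J, l, k; split => // x.
exact: le_trans (fg x) (gle x).
Qed.

Lemma Fu_mk (f : (I -> R) -> R) (g : FuType R I) :
  measurable_fun [set: Cyl R I] (f : Cyl R I -> R) ->
  (forall x, `|f x| <= `|g x|) -> exists f' : FuType R I, forall x, f' x = f x.
Proof.
move=> mf fg; have Ff : f \in @Fu_pred R I.
  rewrite inE; split => //; apply: Fu_dominated_le fg.
  by have := Fu_funP g; rewrite inE => -[].
by exists (MkFu Ff).
Qed.

(** The pointwise supremum is measurable by countability, and affinely dominated because it lies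
    between a member of [A] and an upper bound. *)
Lemma Fu_sup_pointwise (A : set (FuType R I)) : A !=set0 -> countable A ->
  has_ubound A -> exists2 s, supremums A s &
    forall x, supremums [set (f : FuType R I) x | f in A] (s x).
Proof.
move=> A0 /(countable_range _ _ A0)[f AE] [b Ab].
have fb n : f n <= b by apply: Ab; rewrite AE; exists n.
have bx x : ubound (range (fun n => f n x)) (b x).
  by move=> _ [n _ <-]; have /Fu_leP := fb n.
have supP x : has_sup (range (fun n => f n x)).
  by split; [exists (f 0%N x), 0%N|exists (b x)].
pose h x := sup (range (fun n => f n x)).
have mh : measurable_fun [set: Cyl R I] (h : Cyl R I -> R).
  have -> : h = (fun x => sups (fun n => f n x) 0).
    apply/funext => x; rewrite /h /sups; congr sup; rewrite /sdrop/=.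
    by apply/seteqP; split=> _ [n _ <-]; exists n.
  apply: (@measurable_fun_sups _ (Cyl R I) R setT (fun n => f n)).
    by move=> x _; exact: (supP x).2.
  by move=> n; exact: Fu_measurable.
have hf x : f 0%N x <= h x by apply: ub_le_sup; [exact: (supP x).2|exists 0%N].
have hb x : h x <= b x by apply: ge_sup; [exact: (supP x).1|exact: bx].
(* [g] is at least [|h|] because [f 0 <= h <= b]. *)
pose g : FuType R I := rjoin (rjoin (f 0%N) b) (- rmeet (f 0%N) b).
have [s sE] : exists s : FuType R I, forall x, s x = h x.
  apply: (Fu_mk _ g mh) => x; apply: le_trans (ler_norm _).
  rewrite /g !Fu_rjoinE Fu_oppE Fu_rmeetE ler_norml.
  apply/andP; split.
    rewrite lerNl le_max; apply/orP; right.
    rewrite lerN2 (le_trans _ (hf x))// ge_min lexx//.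
  by rewrite !le_max hb orbT.
have lub x : supremums [set (f' : FuType R I) x | f' in A] (s x).
  rewrite sE AE; split.
    move=> _ [_ [n _ <-] <-]; apply: ub_le_sup; first exact: (supP x).2.
    by exists n.
  move=> y Ay; apply: ge_sup; first exact: (supP x).1.
  by move=> _ [n _ <-]; apply: Ay; exists (f n) => //; exists n.
exists s => //; split=> [g' Ag'|g' Ag'].
  by apply/Fu_leP => x; apply: (lub x).1; exists g'.
apply/Fu_leP => x; apply: (lub x).2 => _ [f' Af' <-].
by have /Fu_leP := Ag' _ Af'.
Qed.

Lemma Fu_dedekind_sigma_complete : dedekind_sigma_complete (FuType R I).
Proof.
by move=> A A0 cA bA; have [s ? _] := Fu_sup_pointwise _ A0 cA bA; exists s.
Qed.

(** A supremum is unique, hence equal to the pointwise one. *)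
Lemma Fu_supE (f : nat -> FuType R I) s : supremums (range f) s ->
  forall x, supremums (range (fun n => f n x)) (s x).
Proof.
move=> fs x; have [|||s' fs' lub] := Fu_sup_pointwise (range f).
- by exists (f 0%N), 0%N.
- exact: sub_countable (card_image_le _ _) _.
- by exists s => _ [n _ <-]; apply: fs.1; exists n.
have -> : s = s' by exact: (@is_subset1_supremums _ _ (range f)).
by have := lub x; rewrite image_comp.
Qed.

Lemma Fu_weak_unit : weak_unit (Fu_one : FuType R I).
Proof.
split; first by apply/Fu_leP => x; rewrite Fu_zeroE; exact: ler01.
move=> f f0; apply: Fu_eqP => x; have := congr1 (fun g : FuType R I => g x) f0.
rewrite Fu_rmeetE Fu_zeroE /= /Num.min; case: ifPn => // _ /eqP.
by rewrite /cst oner_eq0.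
Qed.

(** Writing each [|pi_j|] as a join of [pi_j] and its opposite presents the dominating function as a
    Riesz expression in the generators, so that it lies in the domain of the graph below. *)
Lemma Fu_affine_bound f :
  exists (s : seq {classic I}) (l : {classic I} -> R) (k : R), forall x,
    `|f x| <= (k *: Fu_one +
      \sum_(j <- s) l j *: rjoin (Fu_pi (j : I)) (- Fu_pi (j : I))) x.
Proof.
have := Fu_funP f; rewrite inE => -[_ [J [l [k [finJ _ _ fle]]]]].
exists (finmap.enum_fset (fset_set J)), l, k => x; apply: (le_trans (fle x)).
rewrite Fu_addE Fu_scaleE Fu_sumE Fu_oneE mulr1 lerD2l.
rewrite fsbig_finite//.
apply: ler_sum => j _.
by rewrite Fu_scaleE Fu_rjoinE Fu_oppE maxrN.
Qed.

End Fu_order.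

Lemma countable_setU (T : Type) (A B : set T) :
  countable A -> countable B -> countable (A `|` B).
Proof.
move=> cA cB; have -> : A `|` B = \bigcup_(b in [set: bool]) if b then A else B.
  apply/seteqP; split=> [x [Ax|Bx]|x [[] _]].
  - by exists true.
  - by exists false.
  - by left.
  - by right.
by apply: bigcup_countable => // -[].
Qed.

(** * The generated relation is single-valued *)

Section graph.
Context {R : realType} {I : Type} {G : rieszType R} (e : G) (h : I -> G).
Hypotheses (dG : dedekind_sigma_complete G) (we : weak_unit e).
Implicit Types (f g : FuType R I) (x y : G).

(** Being inductive, the relation allows induction on derivations, both to attach countably many
    dense sets to a pair and to prove uniqueness of the morphism. *)
Inductive graph : FuType R I -> G -> Prop :=
| graph_one : graph Fu_one e
| graph_pi i : graph (Fu_pi i) (h i)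
| graph_lin a f g x y : graph f x -> graph g y ->
    graph (a *: f + g) (a *: x + y)
| graph_join f g x y : graph f x -> graph g y -> graph (rjoin f g) (rjoin x y)
| graph_sup (f : nat -> FuType R I) (x : nat -> G) s t :
    (forall n, graph (f n) (x n)) -> supremums (range f) s ->
    supremums (range x) t -> graph s t.

(** A sequence meeting countably many dense sets may leave some [h i] without a value; such
    coordinates default to 0. *)
Definition generic_point (u : nat -> G) : I -> R :=
  fun i => xget 0 [set r | value e u (h i) r].

(** Induction on the derivation: each generator contributes the sets giving [h i] a value, each
    supremum the sets [decides_sup], and the other rules only collect those of their premises. *)
Lemma graph_value f x : graph f x -> exists DD : set (set G),
  [/\ countable DD, forall D, DD D -> dense_cond D &
      forall u, generic DD u -> value e u x (f (generic_point u))].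
Proof.
elim=> {f x}.
- exists set0; split => // u [u0 ud _].
  exact: value_unit.
- move=> i.
  exists ([set bounds e (h i)] `|`
    range (fun q : rat => decides e (h i) (ratr q))).
  split.
  + by apply: countable_setU => //; exact: sub_countable (card_image_le _ _) _.
  + move=> _ [->|[q _ <-]]; first exact: dense_bounds.
    exact: dense_decides.
  + move=> u [u0 ud uD]; rewrite /= /generic_point.
    have [r hr] : exists r, value e u (h i) r.
      apply: value_exists => //; first by apply: uD; left.
      by move=> q; apply: uD; right; exists q.
    by case: xgetP => [_ -> //|/(_ r)].
- move=> a f g x y _ [D1 [cD1 dD1 vD1]] _ [D2 [cD2 dD2 vD2]].
  exists (D1 `|` D2); split; first exact: countable_setU.
    by move=> D [/dD1|/dD2].
  move=> u uD; rewrite Fu_addE Fu_scaleE; have [u0 ud _] := uD.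
  apply: valueD => //; first apply: valueZ => //.
    by apply: vD1; apply: generic_sub uD; exact: subsetUl.
  by apply: vD2; apply: generic_sub uD; exact: subsetUr.
- move=> f g x y _ [D1 [cD1 dD1 vD1]] _ [D2 [cD2 dD2 vD2]].
  exists (D1 `|` D2); split; first exact: countable_setU.
    by move=> D [/dD1|/dD2].
  move=> u uD; rewrite Fu_rjoinE; have [u0 ud _] := uD.
  apply: value_join => //.
    by apply: vD1; apply: generic_sub uD; exact: subsetUl.
  by apply: vD2; apply: generic_sub uD; exact: subsetUr.
- move=> f x s t _ /choice[DD DDP] fs xt.
  exists (\bigcup_n DD n `|` range (fun q : rat => decides_sup e x t (ratr q))).
  split.
  + apply: countable_setU; last exact: sub_countable (card_image_le _ _) _.
    by apply: bigcup_countable => // n _; have [] := DDP n.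
  + move=> D [[n _ Dn]|[q _ <-]]; first by have [_ dn _] := DDP n; exact: dn.
    exact: dense_decides_sup.
  + move=> u uD; have [u0 ud uDD] := uD.
    apply: value_sup (Fu_supE _ _ fs (generic_point u)) => //.
    * exact: xt.
    * by move=> q; apply: uDD; right; exists q.
    * move=> n; have [_ _] := DDP n; apply; apply: generic_sub uD.
      by move=> D Dn; left; exists n.
Qed.

Lemma graph_scale a f x : graph f x -> graph (a *: f) (a *: x).
Proof.
have g0 : graph 0 0.
  have := graph_lin (-1) _ _ _ _ graph_one graph_one.
  by rewrite !scaleN1r !addNr.
by move=> fx; have := graph_lin a _ _ _ _ fx g0; rewrite !addr0.
Qed.

Lemma graph_zero : graph 0 0.
Proof. by have := graph_scale 0 _ _ graph_one; rewrite !scale0r. Qed.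

Lemma graph_add f g x y : graph f x -> graph g y -> graph (f + g) (x + y).
Proof.
by move=> fx gy; have := graph_lin 1 _ _ _ _ fx gy; rewrite !scale1r.
Qed.

Lemma graph_opp f x : graph f x -> graph (- f) (- x).
Proof.
by move=> fx; rewrite -(scaleN1r f) -(scaleN1r x); exact: graph_scale.
Qed.

Lemma graph_meet f g x y : graph f x -> graph g y ->
  graph (rmeet f g) (rmeet x y).
Proof.
move=> /graph_opp fx /graph_opp gy.
by rewrite !rmeetN; exact/graph_opp/graph_join.
Qed.

(** By symmetry [y <= 0] suffices. Otherwise some [n.+1%:R *: y] is not below [e]; a generic
    sequence starting at the positive part of the difference gives [y] a value at least
    [n.+1%:R^-1], whereas [graph_value] gives it the value 0. *)
Lemma graph_eq0 x : graph 0 x -> x = 0.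
Proof.
suff npos y : graph 0 y -> y <= 0.
  move=> gx; apply: le_anti; rewrite npos//= -riesz_leN2 oppr0 npos//.
  by rewrite -[0]oppr0; exact: graph_opp.
move=> gy; apply: contrapT => y0.
have [n yn] : exists n, ~ n.+1%:R *: y <= e.
  apply: contrapT => no; apply: y0; apply: (sigma_archimedean dG y e).
  case=> [|n]; first by rewrite scale0r; exact: we.1.
  by apply: contrapT => yn; apply: no; exists n.
have n0 : 0 < n.+1%:R :> R by [].
pose w := rpos (n.+1%:R *: y - e).
have w0 : 0 < w.
  rewrite lt_def rpos_ge0 andbT; apply/eqP => w0; apply: yn.
  by rewrite -[e]add0r -riesz_le_subl -w0 rpos_ge.
have [DD [cDD dDD vDD]] := graph_value _ _ gy.
have [u uD uw] := generic_exists _ _ cDD dDD w0.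
have [u0 ud _] := uD.
have : n.+1%:R^-1 <= (0 : R).
  apply: value_ge (vDD _ uD) _ => //; exists 0%N; rewrite uw.
  have -> : y = n.+1%:R^-1 *: (n.+1%:R *: y).
    by rewrite scalerA mulVf ?scale1r// gt_eqF.
  apply: local_leZ; rewrite ?invr_ge0 ?rpos_ge0// ?(ltW n0)//.
  exact: local_le_rposB.
by rewrite leNgt invr_gt0 n0.
Qed.

Lemma graph_fun f x y : graph f x -> graph f y -> x = y.
Proof.
move=> fx /graph_opp fy; apply/eqP; rewrite -subr_eq0; apply/eqP.
by apply: graph_eq0; rewrite -(subrr f); exact: graph_add.
Qed.

(** Since [rjoin f g = g], both [y] and [rjoin x y] are related to [g], hence equal. *)
Lemma graph_le f g x y : f <= g -> graph f x -> graph g y -> x <= y.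
Proof.
move=> fg fx gy; suff -> : y = rjoin x y by exact: rjoin_gel.
apply: (graph_fun g) => //; have fgE : rjoin f g = g; last first.
  by have := graph_join _ _ _ _ fx gy; rewrite fgE.
by apply: le_anti; rewrite rjoin_ger rjoin_le fg lexx.
Qed.

Definition in_dom f : Prop := exists x, graph f x.

(** The bound [g] is taken in the domain so that its image bounds the images of the [f n], whose
    supremum then exists in [G]. *)
Lemma in_dom_sup (f : nat -> FuType R I) g s : (forall n, in_dom (f n)) ->
  in_dom g -> (forall n, f n <= g) -> supremums (range f) s -> in_dom s.
Proof.
move=> /choice[x fx] [y gy] fg fs.
have [|||t xt] := dG (range x).
- by exists (x 0%N), 0%N.
- exact: sub_countable (card_image_le _ _) _.
- by exists y => _ [n _ <-]; exact: graph_le (fg n) (fx n) gy.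
by exists t; exact: graph_sup fx fs xt.
Qed.

Lemma in_dom_lin a f g : in_dom f -> in_dom g -> in_dom (a *: f + g).
Proof. by move=> [x fx] [y gy]; exists (a *: x + y); exact: graph_lin. Qed.

Lemma in_dom_add f g : in_dom f -> in_dom g -> in_dom (f + g).
Proof. by move=> /(in_dom_lin 1) /[apply]; rewrite scale1r. Qed.

Lemma in_dom_scale a f : in_dom f -> in_dom (a *: f).
Proof. by move=> [x fx]; exists (a *: x); exact: graph_scale. Qed.

Lemma in_dom_opp f : in_dom f -> in_dom (- f).
Proof. by rewrite -scaleN1r; exact: in_dom_scale. Qed.

Lemma in_dom_join f g : in_dom f -> in_dom g -> in_dom (rjoin f g).
Proof. by move=> [x fx] [y gy]; exists (rjoin x y); exact: graph_join. Qed.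

Lemma in_dom_meet f g : in_dom f -> in_dom g -> in_dom (rmeet f g).
Proof. by move=> [x fx] [y gy]; exists (rmeet x y); exact: graph_meet. Qed.

Lemma in_dom_one : in_dom Fu_one.
Proof. by exists e; exact: graph_one. Qed.

End graph.

(** * The generated relation is total *)

Section totality.
Context {R : realType} {I : Type} {G : rieszType R} (e : G) (h : I -> G).
Hypotheses (dG : dedekind_sigma_complete G) (we : weak_unit e).
Implicit Types (f g : FuType R I) (x y : G) (A : set (I -> R)).

Let dom := in_dom e h.

Lemma in_dom_sup_pointwise (f : nat -> FuType R I) g (v : (I -> R) -> R) :
  (forall n, dom (f n)) -> dom g -> (forall n, f n <= g) ->
  (forall p, supremums (range (fun n => f n p)) (v p)) ->
  exists2 s : FuType R I, dom s & forall p, s p = v p.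
Proof.
move=> df dg fg fv; have [|||s fs lub] := Fu_sup_pointwise (range f).
- by exists (f 0%N), 0%N.
- exact: sub_countable (card_image_le _ _) _.
- by exists g => _ [n _ <-].
exists s; first exact: in_dom_sup dG we _ _ _ df dg fg fs.
by move=> p; apply: is_subset1_supremums (Fu_supE _ _ fs p) (fv p).
Qed.

Definition dom_set A : Prop :=
  exists2 f : FuType R I, dom f & forall p, f p = \1_A p.

Lemma dom_setC A : dom_set A -> dom_set (~` A).
Proof.
move=> [f df fA]; exists (Fu_one - f).
  by apply: in_dom_add; [exact: in_dom_one|exact: in_dom_opp].
move=> p; rewrite Fu_addE Fu_oppE fA !indicE in_setC Fu_oneE.
by case: (p \in A); rewrite /= ?subrr ?subr0.
Qed.

Lemma dom_set_bigcup (F : nat -> set (I -> R)) :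
  (forall n, dom_set (F n)) -> dom_set (\bigcup_n F n).
Proof.
move=> dF; have /choice[f fP] : forall n, exists f : FuType R I,
    dom f /\ forall p, f p = \1_(F n) p.
  by move=> n; have [f] := dF n; exists f.
have df n := (fP n).1; have fF n := (fP n).2.
have [|n|p|s ds sE] := in_dom_sup_pointwise f Fu_one (\1_(\bigcup_n F n)) df.
- exact: in_dom_one.
- by apply/Fu_leP => p; rewrite fF indicE lern1 leq_b1.
- split=> [_ [n _ <-]|b fb].
    rewrite fF !indicE ler_nat; case: (boolP (p \in F n)) => //.
    by rewrite inE => Fp; rewrite mem_set//; exists n.
  have [[n _ Fnp]|np] := pselect ((\bigcup_n F n) p).
    apply: (@le_trans _ _ (f n p)); last by apply: fb; exists n.
    by rewrite fF !indicE !mem_set//; exists n.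
  apply: (@le_trans _ _ (f 0%N p)); last by apply: fb; exists 0%N.
  by rewrite fF !indicE (memNset np) ler0n.
- by exists s.
Qed.

Lemma dom_set0 : dom_set set0.
Proof.
exists 0; first by exists 0; exact: graph_zero.
by move=> p; rewrite indic0.
Qed.

(** The indicator is the supremum over [n] of the truncations at 1 of [n (f - c)^+]. *)
Lemma dom_set_gt f (c : R) : dom f -> dom_set [set p | c < f p].
Proof.
move=> df.
pose g n : FuType R I := rmeet (n%:R *: rjoin (f - c *: Fu_one) 0) Fu_one.
have gE n p : g n p = Num.min (n%:R * Num.max (f p - c) 0) 1.
  rewrite /g Fu_rmeetE Fu_scaleE Fu_rjoinE Fu_addE Fu_oppE Fu_scaleE.
  by rewrite Fu_oneE mulr1.
have [n||n|p|s ds sE] := in_dom_sup_pointwise g Fu_one (\1_[set p | c < f p]).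
- apply: in_dom_meet; last exact: in_dom_one.
  apply/in_dom_scale/in_dom_join; last by exists 0; exact: graph_zero.
  by apply: in_dom_add => //; apply/in_dom_opp/in_dom_scale/in_dom_one.
- exact: in_dom_one.
- by apply/Fu_leP => p; rewrite gE ge_min lexx orbT.
- rewrite indicE; split=> [_ [n _ <-]|b gb].
    rewrite gE; case: (ltP c (f p)) => cf.
      by rewrite mem_set// ge_min lexx orbT.
    rewrite memNset/=; last by apply/negP; rewrite -leNgt.
    by rewrite max_r ?subr_le0// mulr0 ge_min lexx.
  case: (ltP c (f p)) => cf; last first.
    rewrite memNset/=; last by apply/negP; rewrite -leNgt.
    apply: (@le_trans _ _ (g 0%N p)); last by apply: gb; exists 0%N.
    by rewrite gE mul0r le_min lexx ler01.
  (* For this [n] the truncation has already reached 1 at [p]. *)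
  rewrite mem_set//=; pose n := Num.bound (f p - c)^-1.
  apply: (@le_trans _ _ (g n p)); last by apply: gb; exists n.
  have fc : 0 < f p - c by rewrite subr_gt0.
  rewrite gE le_min lexx andbT (max_l (ltW fc)) -ler_pdivrMr// div1r.
  by rewrite ltW// archi_boundP// invr_ge0 ltW.
- by exists s.
Qed.

(** Applied twice below: with [F] the identity for cylinder sets, and with [F] the preimage under a
    projection for Borel sets of reals. *)
Lemma dom_set_sigma_algebra (T : Type) (F : set T -> set (I -> R)) :
  F set0 = set0 -> (forall B, F (~` B) = ~` F B) ->
  (forall B : nat -> set T, F (\bigcup_n B n) = \bigcup_n F (B n)) ->
  sigma_algebra setT [set B | dom_set (F B)].
Proof.
move=> F0 FC FU; split=> [|B dB|B dB] /=.
- by rewrite F0; exact: dom_set0.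
- by rewrite setTD FC; exact: dom_setC.
- by rewrite FU; exact: dom_set_bigcup.
Qed.

Lemma dom_set_measurable A : measurable (A : set (Cyl R I)) -> dom_set A.
Proof.
move: A; apply: smallest_sub; first exact: (dom_set_sigma_algebra _ id).
move=> A [i _ [B mB <-]]; rewrite setTI.
move: B mB; rewrite [measurable]RGenOInfty.measurableE.
apply: (@smallest_sub _ _ _
  [set B | dom_set ((fun p : I -> R => p i) @^-1` B)]).
  by apply: dom_set_sigma_algebra => // B; rewrite preimage_bigcup.
move=> _ [c ->] /=.
have -> : (fun p : I -> R => p i) @^-1` `]c, +oo[%classic =
    [set p | c < (Fu_pi i : FuType R I) p].
  by apply/seteqP; split=> p /=; rewrite in_itv/= andbT.
by apply: dom_set_gt; exists (h i); exact: graph_pi.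
Qed.

Lemma in_dom_ge0 f : 0 <= f -> dom f.
Proof.
move=> /Fu_leP f0.
(* An enumeration of the rationals; numbers that code no rational give 0. *)
pose q n : R := ratr (odflt 0%Q (unpickle n)).
have /choice[d dP] : forall n, exists d : FuType R I,
    dom d /\ forall p, d p = (q n < f p)%R%:R.
  move=> n; have mf : measurable ([set p | q n < f p] : set (Cyl R I)).
    have := Fu_measurable f measurableT `]q n, +oo[%classic (measurable_itv _).
    rewrite setTI; congr measurable.
    by apply/seteqP; split=> p /=; rewrite in_itv/= andbT.
  have [d dd dE] := dom_set_measurable _ mf; exists d; split => // p.
  by rewrite dE indicE; congr (nat_of_bool _)%:R; apply/idP/idP => /[!inE].
pose g n : FuType R I := Num.max (q n) 0 *: d n.
have gE n p : g n p = Num.max (q n) 0 * (q n < f p)%R%:R.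
  by rewrite /g Fu_scaleE (dP n).2.
have g_le n p : g n p <= f p.
  rewrite gE; case: ltP => [qf|_]; rewrite ?mulr1 ?mulr0; last exact: f0.
  by rewrite ge_max ltW//; exact: f0.
have [s [l [k fle]]] := Fu_affine_bound f.
(* The bound comes from [Fu_affine_bound], since [f] is not yet known to lie in the domain. *)
have [n||n|p|f' df' fE] := in_dom_sup_pointwise g
    (k *: Fu_one + \sum_(j <- s) l j *: rjoin (Fu_pi j) (- Fu_pi j)) f.
- by apply: in_dom_scale; exact: (dP n).1.
- apply: in_dom_add; first exact/in_dom_scale/in_dom_one.
  elim: s {fle} => [|j s ih].
    by rewrite big_nil; exists 0; exact: graph_zero.
  rewrite big_cons; apply: in_dom_add => //; apply/in_dom_scale/in_dom_join.
    by exists (h j); exact: graph_pi.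
  by apply: in_dom_opp; exists (h j); exact: graph_pi.
- apply/Fu_leP => p; apply: le_trans (g_le n p) _.
  exact: le_trans (ler_norm _) (fle p).
- split=> [_ [n _ <-]|b gb]; first exact: g_le.
  (* A bound [b < f p] leaves room for a rational [r], whose approximant is at least [r] at [p]. *)
  rewrite leNgt; apply/negP => /rat_in_itvoo[r].
  rewrite in_itv/= => /andP[br rf].
  have qE : q (pickle r) = ratr r by rewrite /q pickleK.
  have : g (pickle r) p <= b by apply: gb; exists (pickle r).
  rewrite gE qE rf mulr1 leNgt => /negP; apply.
  by rewrite lt_max br.
- by rewrite (_ : f = f')//; apply: Fu_eqP => p; rewrite fE.
Qed.

Lemma in_dom_total f : dom f.
Proof.
have -> : f = rjoin f 0 - rjoin (- f) 0.
  by rewrite -[rjoin f 0]/(rpos f) rposE addrK.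
apply: in_dom_add; last apply: in_dom_opp;
  by apply: in_dom_ge0; exact: rjoin_ger.
Qed.

End totality.

(** * Existence and uniqueness of the morphism *)

Section freeness.
Context {R : realType} {I : Type} {G : rieszType R} (e : G) (h : I -> G).
Hypotheses (dG : dedekind_sigma_complete G) (we : weak_unit e).

Lemma Fu_free : exists! phi : FuType R I -> G,
  [/\ riesz_morphism phi, sigma_continuous phi, phi Fu_one = e &
      forall i, phi (Fu_pi i) = h i].
Proof.
have [phi phiP] := choice (in_dom_total e h dG we).
have phiE f x : graph e h f x -> phi f = x.
  by move=> fx; exact: graph_fun (phiP f) fx.
exists phi; split.
  split.
  - split=> [a f g|f g|f g]; apply: phiE.
    + exact: graph_lin.
    + exact: graph_meet.
    + exact: graph_join.
  - move=> A s A0 /(countable_range _ _ A0)[f ->] fs.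
    have phi_le g g' : g <= g' -> phi g <= phi g'.
      by move=> gg'; exact: graph_le gg' (phiP g) (phiP g').
    rewrite image_comp.
    (* The images are bounded by [phi s], so they have a supremum [t]; then [graph_sup] relates [s]
       to [t], and single-valuedness gives [phi s = t]. *)
    have [|||t phit] := dG (range (phi \o f)).
    + by exists (phi (f 0%N)), 0%N.
    + exact: sub_countable (card_image_le _ _) _.
    + exists (phi s) => _ [n _ <-]; apply: phi_le.
      by apply: fs.1; exists n.
    suff -> : phi s = t by [].
    by apply: phiE; apply: graph_sup fs phit => n; exact: phiP.
  - by apply: phiE; exact: graph_one.
  - by move=> i; apply: phiE; exact: graph_pi.
move=> psi [[psi_lin _ psi_join] psi_sup psi1 psi_pi].
(* [psi] respects every rule of [graph], so it follows the derivation of [f] to the same element. *)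
apply/funext => f; elim: (phiP f) => {f} [|i|a f g x y _ fx _ gy|
  f g x y _ fx _ gy|f x s t _ fx fs xt].
- by rewrite psi1.
- by rewrite psi_pi.
- by rewrite psi_lin fx gy.
- by rewrite psi_join fx gy.
- have := psi_sup _ _ _ _ fs.
  rewrite image_comp (_ : psi \o f = x); last first.
    by apply/funext => n /=; rewrite fx.
  move=> psis; apply: is_subset1_supremums xt (psis _ _).
    by exists (f 0%N), 0%N.
  exact: sub_countable (card_image_le _ _) _.
Qed.

End freeness.

(** * Preservation of integrability *)

Section Lfun_criterion.
Context d (T : measurableType d) (R : realType).
Variable mu : {measure set T -> \bar R}.
Implicit Types (f g : T -> R) (p : R).

Lemma measurable_powR_norm f p : measurable_fun setT f ->
  measurable_fun setT (fun x => (`|f x| `^ p)%:E).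
Proof.
move=> mf; apply/measurable_EFinP.
apply: (@measurableT_comp _ _ _ _ _ _ (fun r : R => r `^ p)) => //.
exact: measurableT_comp.
Qed.

Lemma LfunE f p : 1 <= p -> f \in Lfun mu p%:E <->
  measurable_fun setT f /\ (\int[mu]_x (`|f x| `^ p)%:E < +oo)%E.
Proof.
move=> p1; have p0 : p != 0 by rewrite gt_eqF// (lt_le_trans ltr01).
split=> [fL|[mf fp]].
  split; first by move: fL => /andP[]; rewrite inE.
  have /integrableP[_] := Lfun_integrable p1 fL.
  by under eq_integral => x _ do rewrite gee0_abs ?lee_fin ?powR_ge0//.
apply/andP; split; rewrite inE//= /finite_norm unlock /=.
by rewrite poweR_lty.
Qed.

Lemma Lfun_dominated f g p : 1 <= p -> measurable_fun setT f ->
  (forall x, `|f x| <= `|g x|) -> g \in Lfun mu p%:E -> f \in Lfun mu p%:E.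
Proof.
move=> p1 mf fg gL; have [mg gp] := (LfunE g p p1).1 gL.
apply/LfunE => //; split => //.
apply: le_lt_trans gp; apply: ge0_le_integral => //; last first.
  move=> x _; rewrite lee_fin ge0_ler_powR// ?nnegrE//.
  by rewrite (le_trans ler01).
all: try exact: measurable_powR_norm.
all: by move=> x _; rewrite lee_fin powR_ge0.
Qed.

Lemma Lfun_cst_finite (c : R) p : 1 <= p -> (mu setT < +oo)%E ->
  cst c \in Lfun mu p%:E.
Proof.
move=> p1 muT; apply/LfunE => //; split => //.
rewrite (_ : (fun x => _) = cst (`|c| `^ p)%:E)//.
by rewrite integral_cst// lte_mul_pinfty// lee_fin powR_ge0.
Qed.

Lemma Lfun_sum (J : Type) (s : seq J) (F : J -> T -> R) p : 1 <= p ->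
  (forall j, F j \in Lfun mu p%:E) ->
  (fun x => \sum_(j <- s) F j x) \in Lfun mu p%:E.
Proof.
move=> p1 FL; have p1' : (1 <= p%:E)%E by rewrite lee_fin.
have [L0 LD] := Lfun_addr_closed mu p1'.
elim: s => [|j s ih].
  by under eq_fun do rewrite big_nil; exact: L0.
under eq_fun do rewrite big_cons.
exact: LD.
Qed.

End Lfun_criterion.

(** * Members of [Fu] preserve integrability; preserving functions are measurable *)

Section Fu_preserves.
Context {R : realType} {I : Type}.
Implicit Types tau : (I -> R) -> R.

Lemma measurable_fun_Cyl d (T : measurableType d) (f : I -> T -> R) :
  (forall i, measurable_fun setT (f i)) ->
  measurable_fun setT (fun x => (fun i => f i x) : Cyl R I).
Proof.
move=> mf.
apply: (@measurability _ _ T (Cyl R I) setT _ (@cylinders R I)) => //.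
move=> _ [_ [i _ [B mB <-]] <-]; rewrite !setTI.
by have := mf i measurableT B mB; rewrite setTI.
Qed.

(** The composite is measurable and bounded by an affine combination of the [|f j|], whose constant
    term is p-integrable because the measure is finite. *)
Lemma Fu_preserves tau p : 1 <= p -> Fu tau -> preserves_pintegrability p tau.
Proof.
move=> p1 [mtau [J [l [k [finJ l0 k0 tau_le]]]]] d T mu f muT fL.
have mf i : measurable_fun setT (f i).
  by have [] := (LfunE _ _ _ mu (f i) p p1).1 (fL i).
pose g (x : T) := k + \sum_(j <- finmap.enum_fset (fset_set J)) l j * `|f j x|.
apply: (@Lfun_dominated _ _ _ mu _ g) => //.
- exact: (measurableT_comp mtau (measurable_fun_Cyl _ _ _ mf)).
- move=> x; apply: le_trans (tau_le _) _; rewrite fsbig_finite//.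
  exact: ler_norm.
- have p1' : (1 <= p%:E)%E by rewrite lee_fin.
  have [_ LD] := Lfun_addr_closed mu p1'.
  apply: (LD (cst k)); first exact: Lfun_cst_finite.
  apply: Lfun_sum => // j.
  have -> : (fun x => l j * `|f j x|) = l j \o* (fun x => `|f j x|).
    by apply/funext => x; rewrite /= mulrC.
  apply: Lfun_scale => //; apply: Lfun_dominated (fL j) => //.
    exact: measurableT_comp.
  by move=> x; rewrite normr_id.
Qed.

Lemma preserves_measurable tau p : 1 <= p -> preserves_pintegrability p tau ->
  measurable_fun setT (tau : Cyl R I -> R).
Proof.
(* With the projections as family the composite is [tau] itself, and for the zero measure membership
   in L^p amounts to measurability. *)
move=> p1 /(_ _ (Cyl R I) mzero (fun i x => x i)) tauL.
have mu0 : (@mzero _ (Cyl R I) R setT < +oo)%E by rewrite /mzero.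
have piL i : (fun x : Cyl R I => x i) \in Lfun (@mzero _ (Cyl R I) R) p%:E.
  have [mi _] := @Fu_proj R I i; apply/LfunE => //; split; first exact: mi.
  by rewrite integral_measure_zero.
by have [] := (LfunE _ _ _ _ _ _ p1).1 (tauL mu0 piL).
Qed.

End Fu_preserves.

(** * Dependence on countably many coordinates *)

Section countable_support.
Context {R : realType} {I : Type}.

Definition agree (J : set I) (x y : I -> R) : Prop :=
  forall j, J j -> x j = y j.

(** Sets depending on countably many coordinates form a sigma-algebra containing the generating
    cylinders. *)
Lemma Cyl_countable_support (A : set (Cyl R I)) : measurable A ->
  exists2 J : set I, countable J &
    forall x y : I -> R, agree J x y -> A x -> A y.
Proof.
move: A; apply: smallest_sub.
  split=> /=.
  - by exists set0 => // x y.
  - move=> A [J cJ JA]; exists J => // x y xy [_ nAx]; split => // Ay.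
    by apply: nAx; apply: JA Ay => j /xy.
  - move=> A /(_ _)/cid2; rewrite -/(forall n, _) => /all_sig2[J cJ JA].
    exists (\bigcup_n J n); first exact: bigcup_countable.
    move=> x y xy [n _ Anx]; exists n => //; apply: JA Anx => j Jj.
    by apply: xy; exists n.
move=> _ [i _ [B mB <-]]; exists [set i] => // x y xy [_ Bx]; split => //.
by rewrite /preimage/= -(xy i).
Qed.

(** The supports of the sets [f > q], for rational [q], are united; two distinct values of [f] would
    be separated by such a set. *)
Lemma Cyl_fun_countable_support (f : Cyl R I -> R) : measurable_fun setT f ->
  exists2 J : set I, countable J &
    forall x y : I -> R, agree J x y -> f x = f y.
Proof.
move=> mf.
have dep q : exists J : set I, countable J /\
    forall x y : I -> R, agree J x y -> ratr q < f x -> ratr q < f y.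
  have := mf measurableT `]ratr q, +oo[%classic (measurable_itv _).
  rewrite setTI => /Cyl_countable_support[J cJ JA]; exists J; split => // x y.
  by move=> /JA; rewrite /= !in_itv/= !andbT.
have [J JP] := choice dep.
exists (\bigcup_q J q).
  by apply: bigcup_countable => // q _; exact: (JP q).1.
have le_f x y : agree (\bigcup_q J q) x y -> f x <= f y.
  move=> xy; rewrite leNgt; apply/negP => /rat_in_itvoo[q].
  rewrite in_itv/= => /andP[yq qx].
  suff : ratr q < f y by rewrite ltNge ltW.
  by apply: (JP q).2 qx => j Jj; apply: xy; exists q.
move=> x y xy; apply: le_anti; rewrite !le_f// => j Jj.
by rewrite xy.
Qed.

End countable_support.

(** * Weighted sums of point masses on the natural numbers *)

Section weighted_series_measure.
Context {R : realType} (w : nat -> {nonneg R}).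

Definition weighted_sum : {measure set nat -> \bar R} :=
  mseries (fun n => mscale (w n) (\d_n : {measure set nat -> \bar R})) 0.

Lemma integral_weighted_sum (f : nat -> \bar R) : (forall n, 0 <= f n)%E ->
  (\int[weighted_sum]_n f n = \sum_(n <oo) (w n)%:num%:E * f n)%E.
Proof.
move=> f0; rewrite ge0_integral_measure_series//.
apply: eq_eseriesr => n _.
by rewrite ge0_integral_mscale// integral_dirac// diracT mul1e.
Qed.

End weighted_series_measure.

(** The first [m] terms have a finite sum, and the tail is compared with a geometric series. *)
Lemma nneseries_halves_lty (R : realType) (a : nat -> R) (m : nat) :
  (forall n, 0 <= a n) -> (forall n, (m <= n)%N -> a n <= 2^-1 ^+ n.+1) ->
  (\sum_(n <oo) (a n)%:E < +oo)%E.
Proof.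
move=> a0 am.
rewrite (nneseries_split _ m); last by move=> k _; rewrite lee_fin.
rewrite add0n sumEFin lte_add_pinfty ?ltry//.
pose v n : \bar R := (1 / (2 ^ n.+1)%:R)%:E.
have v0 n : (0 <= v n)%E by rewrite lee_fin divr_ge0.
apply: (@le_lt_trans _ _ (\sum_(n <oo) v n)%E); last first.
  by rewrite (le_lt_trans (epsilon_trick0 xpredT ler01))// ltry.
rewrite [leRHS](nneseries_split _ m)// add0n.
apply: le_trans (leeDr _ _); last by apply: sume_ge0.
rewrite [leLHS]eseries_cond [leRHS]eseries_cond.
apply: lee_nneseries => [n _ _|n /andP[_ mn]]; first by rewrite lee_fin.
by rewrite lee_fin div1r natrX -exprVn am.
Qed.

(** * Preserving functions are affinely dominated *)

Section domination.
Context {R : realType} {I : Type}.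

Lemma powR_le_id (x p : R) : 0 <= x <= 1 -> 1 <= p -> x `^ p <= x.
Proof.
move=> /andP[]; rewrite le_eqVlt => /predU1P[<- _ p1|x0 x1 p1].
  by rewrite powR0// gt_eqF// (lt_le_trans ltr01).
by apply: ge1r_powR => //; rewrite x0.
Qed.

(** The ratio [|y| / a] is at most [c^-1 <= 1], and on the unit interval a power [p >= 1] only
    decreases it. *)
Lemma weighted_term_le (a y c p : R) : 1 <= p -> 1 <= c -> 0 < a ->
  `|y| * c <= a -> (a^-1) `^ p * `|y| `^ p <= c^-1.
Proof.
move=> p1 c1 a0 yca; have c0 : 0 < c by rewrite (lt_le_trans ltr01).
have ya : a^-1 * `|y| <= c^-1.
  by rewrite mulrC ler_pdivrMr// mulrC ler_pdivlMr.
have a'0 : 0 <= a^-1 by rewrite invr_ge0 ltW.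
rewrite -powRM//; apply: (le_trans _ ya); apply: powR_le_id => //.
by rewrite mulr_ge0//= (le_trans ya)// invf_le1.
Qed.

Lemma preserves_dominated (tau : (I -> R) -> R) (p : R) : 1 <= p ->
  preserves_pintegrability p tau -> affinely_dominated tau.
Proof.
move=> p1 pres; have [J cJ Jtau] :=
  Cyl_fun_countable_support _ (preserves_measurable _ _ p1 pres).
(* If [J] is empty, [tau] is constant; otherwise [s] enumerates [J]. *)
have [J0|/set0P J0] := eqVneq J set0.
  exists set0, (fun=> 0), `|tau (fun=> 0)|; split => // x.
  by rewrite fsbig_set0 addr0 (Jtau x (fun=> 0))// => j; rewrite J0.
have [s Js] := countable_range _ _ J0 cJ.
apply: contrapT => ndom.
(* The inverses of the [c n] are summable and will bound the terms of the series. *)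
pose c n : R := 2 ^+ n.+1.
have c1 n : 1 <= c n by rewrite exprn_ege1// ler1n.
have c0 n : 0 < c n by rewrite (lt_le_trans ltr01).
pose K n : set {classic I} := s @` `I_n.
have /choice[X XP] : forall n, exists x : I -> R,
    c n + \sum_(j \in K n) c n * `|x j| < `|tau x|.
  move=> n; apply: contrapT => nox; apply: ndom.
  exists (K n), (fun=> c n), (c n); split => //.
  - by apply: finite_image.
  - by move=> j _; exact: ltW.
  - exact: ltW.
  - by move=> x; rewrite leNgt; apply/negP => xtau; apply: nox; exists x.
pose a n := `|tau (X n)|.
have sum0 n : 0 <= \sum_(j \in K n) c n * `|X n j|.
  by apply: fsumr_ge0 => j _; rewrite mulr_ge0// ltW.
have ca n : c n <= a n by rewrite ltW// (le_lt_trans _ (XP n))// lerDl.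
have a0 n : 0 < a n by rewrite (lt_le_trans (c0 n)).
(* The coordinate [s m] occurs in the sum over [K n] as soon as [n > m]; finitely many earlier terms
   do not affect integrability. *)
have Xa m n : (m < n)%N -> `|X n (s m)| * c n <= a n.
  move=> mn; rewrite ltW// (le_lt_trans _ (XP n))//.
  rewrite (fsbigD1 (s m : {classic I}))//=; last 2 first.
    by apply: finite_image.
    by exists m.
  rewrite mulrC addrCA lerDl addr_ge0//; first exact: ltW.
  by apply: fsumr_ge0 => j _; rewrite mulr_ge0// ltW.
pose w n : {nonneg R} := NngNum (powR_ge0 (a n)^-1 p).
(* Nothing controls the coordinates of [X n] outside [J]; they are set to 0, which [tau] does not
   see. *)
pose f i n := if `[< J i >] then X n i else 0.
have tauf n : tau (fun i => f i n) = tau (X n).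
  by apply: Jtau => j Jj; rewrite /f asboolT.
have lty (g : nat -> R) m : (forall n, (m <= n)%N -> `|g n| * c n <= a n) ->
    (\int[weighted_sum w]_n (`|g n| `^ p)%:E < +oo)%E.
  move=> ga; rewrite integral_weighted_sum; last first.
    by move=> n; rewrite lee_fin powR_ge0.
  under eq_eseriesr do rewrite -EFinM.
  apply: (nneseries_halves_lty _ _ m) => n.
    by rewrite mulr_ge0// powR_ge0.
  move=> mn; rewrite exprVn.
  by apply: (weighted_term_le (a n) (g n) (c n)) => //; exact: ga.
have muT : (weighted_sum w setT < +oo)%E.
  have := lty (fun=> 1) 0%N; rewrite normr1 powR1 integral_cst// mul1e; apply.
  by move=> n _; rewrite mul1r.
have fL i : f i \in Lfun (weighted_sum w) p%:E.
  apply/LfunE => //; split => //.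
  have [Ji|nJi] := pselect (J i); last first.
    by apply: (lty _ 0%N) => n _; rewrite /f asboolF// normr0 mul0r ltW.
  move: (Ji); rewrite Js => -[m _ smi].
  by apply: (lty _ m.+1) => n mn; rewrite /f asboolT// -smi; exact: Xa.
have [_] := (LfunE _ _ _ _ _ _ p1).1 (pres _ _ _ _ muT fL).
rewrite integral_weighted_sum; last by move=> n; rewrite lee_fin powR_ge0.
(* The weight [(a n)^-1]^ p[exactly cancels]|tau (X n)| [^ p], so each term is 1. *)
rewrite (eq_eseriesr (g := fun=> 1%E)); last first.
  move=> n _; rewrite tauf -EFinM -powRM ?mulVf ?powR1//.
    by rewrite gt_eqF.
  by rewrite invr_ge0 ltW.
move=> sum1; pose S := (\sum_(n <oo) 1%:E : \bar R)%E.
have S_ge n : (n%:R%:E <= S)%E.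
  have := @nneseries_lim_ge R (fun=> 1%E) xpredT 0%N n (fun _ _ _ => lee01).
  by rewrite sumEFin sumr_const_nat subn0.
have Sfin : S \is a fin_num by rewrite ge0_fin_numE// (le_trans _ (S_ge 0%N)).
(* A finite sum of infinitely many ones would bound every natural number. *)
have := S_ge (Num.bound (fine S)).
rewrite -(fineK Sfin) lee_fin leNgt archi_boundP//.
by rewrite fine_ge0// (le_trans _ (S_ge 0%N)).
Qed.

End domination.

Theorem corollary12p4 (R : realType) (I : Type) :
  [/\ @Fu R I = [set tau | preserves_integrability tau],
      forall p : R, 1 <= p ->
        @Fu R I = [set tau | preserves_pintegrability p tau],
      dedekind_sigma_complete (FuType R I),
      weak_unit (Fu_one : FuType R I) &
      forall (G : rieszType R) (e : G) (h : I -> G),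
        dedekind_sigma_complete G -> weak_unit e ->
        exists! phi : FuType R I -> G,
          [/\ riesz_morphism phi, sigma_continuous phi, phi Fu_one = e &
              forall i, phi (Fu_pi i) = h i]].
Proof.
have FuE (p : R) : 1 <= p ->
    @Fu R I = [set tau | preserves_pintegrability p tau].
  move=> p1; apply/seteqP; split=> tau /= tauP; first exact: Fu_preserves.
  split; first exact: preserves_measurable tauP.
  exact: preserves_dominated tauP.
split => //.
- apply/seteqP; split=> tau /= tauP.
    by exists 1 => //; exact: Fu_preserves.
  by have [p p1 ppres] := tauP; rewrite (FuE p p1).
- exact: Fu_dedekind_sigma_complete.
- exact: Fu_weak_unit.
- by move=> G e h dG we; exact: Fu_free.
Qed.
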